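(* Let $B_n(x)$ denote the $n$-th Bernoulli polynomial and, for $n\ge 1$, let $y_n$ be the largest real root of $B_n(x)$. Then, as $n\to\infty$, $$y_n=\frac{n}{2\pi e}+\frac{\ln n}{4\pi e}+O(1).$$
   Context: The Bernoulli polynomials $B_n(x)\in\mathbb{Q}[x]$ are defined by the identity $\frac{te^{tx}}{e^t-1}=\sum_{n=0}^\infty \frac{B_n(x)}{n!}t^n$ in $\mathbb{Q}[x][[t]]$; e.g. $B_0=1$, $B_1=x-\tfrac12$, $B_2=x^2-x+\tfrac16$. For every $n\ge1$, $B_n$ has at least one real root. *)

(* Defs.v *)
From mathcomp Require Import all_boot all_order all_algebra.
From mathcomp Require Import all_classical all_reals all_analysis.
Set Implicit Arguments.
Unset Strict Implicit.
Unset Printing Implicit Defensive.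
Import Order.TTheory GRing.Theory Num.Theory.
Import numFieldNormedType.Exports.
Local Open Scope ring_scope.

(* A formal power series [sum_n u_n t^n] over [rat[x]] is represented by its
   coefficient sequence [u]. *)
Definition fps := nat -> {poly rat}.

Definition fps_mul (u v : fps) : fps :=
  fun n => \sum_(i < n.+1) u i * v (n - i)%N.

Definition fps_one : fps := fun n => (n == 0)%:R.

Definition fps_t : fps := fun n => (n == 1)%:R.

(* [e^(a t)], for [a] in [rat[x]] *)
Definition fps_exp (a : {poly rat}) : fps := fun n => n`!%:R^-1 *: a ^+ n.

(* [rat[x]][[t]] is an integral domain, so that the quotient
   [t e^(x t) / (e^t - 1)] is the only series whose product with [e^t - 1] is
   [t e^(x t)]. *)
Definition bernoulli_polynomials (B : nat -> {poly rat}) : Prop :=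
  forall n, fps_mul (fun k => fps_exp 1 k - fps_one k)
                    (fun k => k`!%:R^-1 *: B k) n
            = fps_mul fps_t (fps_exp 'X) n.

Lemma bernoulli_polynomialsE (B : nat -> {poly rat}) :
  bernoulli_polynomials B <->
  forall n, n`!%:R^-1 *: B n =
    n`!%:R^-1 *: 'X^n
    - \sum_(i < n) (n - i).+1`!%:R^-1 *: (i`!%:R^-1 *: B i).
Proof.
have coefS n : fps_mul (fun k => fps_exp 1 k - fps_one k)
    (fun k => k`!%:R^-1 *: B k) n.+1 =
    n`!%:R^-1 *: B n + \sum_(i < n) (n - i).+1`!%:R^-1 *: (i`!%:R^-1 *: B i).
  rewrite /fps_mul big_ord_recl /= /fps_exp /fps_one expr0 fact0 invr1 scale1r.
  rewrite subrr mul0r add0r big_ord_recl /= expr1 /bump /= subr0 subn1 /=.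
  rewrite (_ : 1`! = 1)%N // invr1 scale1r mul1r; congr (_ + _).
  rewrite (reindex_inj rev_ord_inj) /=; apply: eq_bigr => i _.
  rewrite expr1n subr0 -scalerAl mul1r !add1n subSS subnSK // subKn //.
  exact: ltnW.
have tS n : fps_mul fps_t (fps_exp 'X) n.+1 = n`!%:R^-1 *: 'X^n.
  rewrite /fps_mul big_ord_recl /= /fps_t mul0r add0r big_ord_recl /= mul1r.
  rewrite /bump /= subn1 big1 ?addr0 // => i _; by rewrite mul0r.
split=> BP n; first by rewrite -tS -BP coefS addrK.
case: n => [|n]; last by rewrite coefS tS BP subrK.
by rewrite /fps_mul !big_ord1 /fps_exp /fps_one /fps_t expr0 fact0 invr1
  scale1r subrr !mul0r.
Qed.

Lemma bernoulli_polynomials_unique (B C : nat -> {poly rat}) :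
  bernoulli_polynomials B -> bernoulli_polynomials C -> B = C.
Proof.
move=> /bernoulli_polynomialsE BE /bernoulli_polynomialsE CE.
apply/funext; elim/ltn_ind => n IHn.
have fn0 : n`!%:R^-1 != 0 :> rat by rewrite invr_eq0 pnatr_eq0 -lt0n fact_gt0.
apply: (scalerI fn0); rewrite BE CE; congr (_ - _).
by apply: eq_bigr => i _; rewrite IHn.
Qed.

Lemma bernoulli_polynomials_exist : exists B, bernoulli_polynomials B.
Proof.
pose next (s : seq {poly rat}) : {poly rat} := let n := size s in
  'X^n - n`!%:R *: \sum_(i < n) (n - i).+1`!%:R^-1 *: (i`!%:R^-1 *: s`_i).
pose S n := iter n (fun s => rcons s (next s)) [::].
have sizeS n : size (S n) = n by elim: n => //= n IHn; rewrite size_rcons IHn.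
have nthS n k : (k < n)%N -> (S n)`_k = next (S k).
  elim: n => // n IHn; rewrite ltnS leq_eqVlt => /predU1P[->|kn].
    by rewrite /= nth_rcons sizeS ltnn eqxx.
  by rewrite /= nth_rcons sizeS kn IHn.
exists (fun n => next (S n)); apply/bernoulli_polynomialsE => n.
rewrite {1}/next sizeS scalerBr scalerA mulVf ?pnatr_eq0 -?lt0n ?fact_gt0 //.
by rewrite scale1r; congr (_ - _); apply: eq_bigr => i _; rewrite nthS.
Qed.

Definition largest_real_root (R : realType) (p : {poly rat}) (y : R) : Prop :=
  root (map_poly ratr p) y /\
  forall z : R, root (map_poly ratr p) z -> z <= y.

(* Main.v *)
(* Write b_n = B_n / n!, so that b_n' = b_(n-1), and w = 2 pi. For s in [0, 1]
   and m a natural number, b_(n+1)(s + m) is the sum of b_(n+1)(s) and of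
   (1 / n!) sum_(j < m) (s + j)^n; this sum of powers is comparable to the power
   at the point s + m - 1 and at most (s + m)^n as long as s + m <= n + 1.
   The periodic part b_n(s) is of exact order w^-n on [0, 1]:
   - for n odd, |w^n b_n(s)| <= w^3 sin(w s) on [0, 1/2] follows by induction
     from n to n + 2, since the difference of the two sides vanishes at 0 and 1/2 and
     is concave by the induction hypothesis; reflection, then integration from a
     zero of b_n, give |b_n| <= w^(4-n) on [0, 1] for all n >= 3;
   - the integral over [0, 1] of b_n(s) (1 + cos(w s - n pi / 2)) is - w^-n, as
     seen by repeated integration by parts, hence b_n takes a value at most
     - w^-n / 2.
   So the sign of b_(n+1) changes for the last time within O(1) of the x such
   that x^n = n! w^-n, and Stirling's formula up to a constant factor yields
   x = n / (2 pi e) + ln n / (4 pi e) + O(1). *)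
Require Import Defs.
From mathcomp Require Import all_boot all_order all_algebra.
From mathcomp Require Import all_classical all_reals all_analysis.
From mathcomp Require Import ring lra.
Import Order.TTheory GRing.Theory Num.Theory.
Import numFieldNormedType.Exports.
Local Open Scope classical_set_scope.
Local Open Scope ring_scope.

(** * Identities for the normalized Bernoulli polynomials *)

(* [b n] stands for [B_n / n!]. *)
Definition normalized_bernoulli {R : numFieldType} (b : nat -> {poly R}) :=
  forall n, \sum_(i < n.+1) (n.+1 - i)`!%:R^-1 *: b i = n`!%:R^-1 *: 'X^n.

Lemma fact_neq0 (R : numFieldType) (n : nat) : n`!%:R != 0 :> R.
Proof. by rewrite pnatr_eq0 -lt0n fact_gt0. Qed.

Lemma normalized_bernoulli_map (R : numFieldType) (B : nat -> {poly rat}) :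
  bernoulli_polynomials B ->
  normalized_bernoulli (fun n => n`!%:R^-1 *: map_poly (ratr : rat -> R) (B n)).
Proof.
move=> /bernoulli_polynomialsE BE n.
have ratrf k : ratr (k`!%:R^-1) = k`!%:R^-1 :> R by rewrite fmorphV rmorph_nat.
have := congr1 (map_poly (ratr : rat -> R)) (BE n).
rewrite rmorphB /= !map_polyZ map_polyXn /= ratrf => E.
rewrite big_ord_recr /= subSn // subnn invr1 scale1r E rmorph_sum /= addrC.
rewrite [X in _ - X](eq_bigr (fun i : 'I_n =>
  (n.+1 - i)`!%:R^-1 *: (i`!%:R^-1 *: map_poly (ratr : rat -> R) (B i)))).
  by rewrite subrK.
by move=> i _; rewrite !map_polyZ /= !ratrf subSn // ltnW.
Qed.

Lemma normalized_bernoulliE (R : numFieldType) (b : nat -> {poly R}) (n : nat) :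
  normalized_bernoulli b ->
  b n = n`!%:R^-1 *: 'X^n - \sum_(i < n) (n.+1 - i)`!%:R^-1 *: b i.
Proof.
move=> /(_ n); rewrite big_ord_recr /= subSn // subnn invr1 scale1r => <-.
by rewrite addrAC subrr add0r.
Qed.

Lemma normalized_bernoulli0 (R : numFieldType) (b : nat -> {poly R}) :
  normalized_bernoulli b -> b 0%N = 1.
Proof.
move=> hb; rewrite (normalized_bernoulliE _ _ _ hb) big_ord0 subr0.
by rewrite fact0 invr1 scale1r expr0.
Qed.

(** Strong induction: differentiating the recurrence for [b n.+1] term by term lowers each index by
    one, and the term [i = 0] is constant. *)
Lemma deriv_normalized_bernoulli (R : numFieldType) (b : nat -> {poly R}) n :
  normalized_bernoulli b -> (b n.+1)^`() = b n.
Proof.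
move=> hb; elim/ltn_ind: n => n IHn.
rewrite (normalized_bernoulliE _ _ _ hb) derivB derivZ derivXn.
rewrite raddf_sum /= big_ord_recl /= derivZ (normalized_bernoulli0 _ _ hb).
rewrite derivC scaler0 add0r [RHS](normalized_bernoulliE _ _ _ hb).
congr (_ - _).
  rewrite -['X^_ *+ _]scaler_nat scalerA; congr (_ *: _).
  by rewrite factS natrM invfM mulrAC mulVf ?mul1r ?pnatr_eq0.
apply: eq_bigr => i _; rewrite derivZ /bump /= add1n IHn ?ltn_ord //.
Qed.

Lemma size_normalized_bernoulli (R : numFieldType) (b : nat -> {poly R}) n :
  normalized_bernoulli b -> (size (b n) <= n.+1)%N.
Proof.
move=> hb; elim/ltn_ind: n => n IHn; rewrite (normalized_bernoulliE _ _ _ hb).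
rewrite (leq_trans (size_polyD _ _)) // geq_max size_polyN.
rewrite (leq_trans (size_scale_leq _ _)) ?size_polyXn //=.
rewrite (leq_trans (size_sum _ _ _)) //; apply/bigmax_leqP => i _.
rewrite (leq_trans (size_scale_leq _ _)) // (leq_trans (IHn _ _)) //.
by rewrite ltnS ltnW.
Qed.

Lemma normalized_bernoulli_taylor (R : numFieldType) (b : nat -> {poly R})
    (n : nat) (x y : R) : normalized_bernoulli b ->
  (b n).[x + y] = \sum_(i < n.+1) (n - i)`!%:R^-1 * (b i).[x] * y ^+ (n - i).
Proof.
move=> hb; have dn i : (i <= n)%N -> (b n)^`(i) = b (n - i)%N.
  elim: i => [|i IHi] lein; first by rewrite derivn0 subn0.
  rewrite derivnS IHi ?(ltnW lein) // -[(n - i)%N]prednK ?subn_gt0 //.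
  by rewrite deriv_normalized_bernoulli // subnS.
rewrite (nderiv_taylor_wide (n := n.+1)) ?size_normalized_bernoulli //; last first.
  exact: mulrC.
rewrite (reindex_inj rev_ord_inj) /=; apply: eq_bigr => i _; rewrite subSS.
congr (_ * _); have lein : (n - i <= n)%N by exact: leq_subr.
have := congr1 (horner^~ x) (nderivn_def (n - i)%N (b n)).
rewrite dn // subKn; last by rewrite -ltnS.
by rewrite hornerMn -mulr_natl => ->; rewrite mulrA mulVf ?fact_neq0 ?mul1r.
Qed.

(** In the Taylor expansion with increment 1, the terms of index at most [n] add up to the left side
    of the defining recurrence. *)
Lemma normalized_bernoulliD1 (R : numFieldType) (b : nat -> {poly R})
    (n : nat) (x : R) : normalized_bernoulli b ->
  (b n.+1).[x + 1] = (b n.+1).[x] + n`!%:R^-1 * x ^+ n.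
Proof.
move=> hb; rewrite normalized_bernoulli_taylor // big_ord_recr /= subnn.
rewrite fact0 invr1 mul1r mulr1 addrC; congr (_ + _).
have := congr1 (horner^~ x) (hb n).
rewrite hornerZ hornerXn => <-; rewrite horner_sum; apply: eq_bigr => i _.
by rewrite hornerZ expr1n mulr1.
Qed.

Lemma normalized_bernoulliDn (R : numFieldType) (b : nat -> {poly R})
    (n m : nat) (x : R) : normalized_bernoulli b ->
  (b n.+1).[x + m%:R] =
  (b n.+1).[x] + n`!%:R^-1 * \sum_(j < m) (x + j%:R) ^+ n.
Proof.
move=> hb; elim: m => [|m IHm]; first by rewrite big_ord0 mulr0 !addr0.
rewrite -natr1 addrA normalized_bernoulliD1 // IHm big_ord_recr /=.
by rewrite mulrDr addrA.
Qed.

(* The sequence [(-1)^n b_n(1 - x)] satisfies the recurrence that determines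
   [b_n(x)], by the Taylor expansion with increment [-1]. *)
Lemma normalized_bernoulliB1 (R : numFieldType) (b : nat -> {poly R})
    (n : nat) (x : R) : normalized_bernoulli b ->
  (b n).[1 - x] = (-1) ^+ n * (b n).[x].
Proof.
move=> hb; suff : (-1) ^+ n * (b n).[1 - x] = (b n).[x].
  by move=> <-; rewrite mulrA -expr2 sqrr_sign mul1r.
have hbx k : \sum_(i < k.+1) (k.+1 - i)`!%:R^-1 * (b i).[x] = k`!%:R^-1 * x ^+ k.
  rewrite -hornerXn -hornerZ -hb horner_sum.
  by apply: eq_bigr => i _; rewrite hornerZ.
have hcx k : \sum_(i < k.+1) (k.+1 - i)`!%:R^-1 * ((-1) ^+ i * (b i).[1 - x]) =
    k`!%:R^-1 * x ^+ k.
  have := normalized_bernoulli_taylor _ _ k.+1 (1 - x) (-1) hb.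
  rewrite addrAC subrr sub0r big_ord_recr /= subnn fact0 invr1 mul1r expr0 mulr1.
  rewrite [1 - x]addrC normalized_bernoulliD1 // => /eqP.
  rewrite addrCA -subr_eq0 opprD addrA subrr sub0r oppr_eq0 addrC addr_eq0.
  move=> /eqP/(congr1 (fun z => (-1) ^+ k * z)).
  rewrite mulrCA -exprMn mulN1r opprK mulrN => ->.
  rewrite -[RHS]mulN1r [RHS]mulrA -exprS mulr_sumr; apply: eq_bigr => i _.
  have leik : (i <= k.+1)%N by apply/ltnW/ltn_ord.
  set e := (-1) ^+ (k.+1 - i); have ee : e * e = 1 by rewrite -expr2 sqrr_sign.
  have -> : (-1) ^+ k.+1 = (-1) ^+ i * e by rewrite -exprD subnKC.
  by rewrite -[LHS]mulr1 -[X in _ * X = _]ee; ring.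
elim/ltn_ind: n => n IHn.
have := hcx n; rewrite -hbx !big_ord_recr /= subSn // subnn invr1 !mul1r.
by under eq_bigr do rewrite IHn //; move=> /addrI.
Qed.

(** * Comparison by second derivatives and sine estimates *)

Lemma MVT_everywhere (R : realType) (f df : R -> R) (a b : R) : a < b ->
  (forall x : R, is_derive x (1 : R) f (df x)) ->
  exists2 c, a < c < b & f b - f a = df c * (b - a).
Proof.
move=> ab fdf; have [//|c cab fab] := @MVT R f df a b ab (fun x _ => fdf x).
  apply: derivable_within_continuous => x _; exact: ex_derive.
by exists c => //; move: cab; rewrite in_itv.
Qed.

(** A negative value at [x] would give [df] a negative value to the left of [x] and a positive one
    to the right, hence [ddf] a positive value in between. *)
Lemma concave_ge0 (R : realType) (f df ddf : R -> R) (a b : R) :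
  (forall x : R, is_derive x (1 : R) f (df x)) ->
  (forall x : R, is_derive x (1 : R) df (ddf x)) ->
  (forall x, a <= x <= b -> ddf x <= 0) -> 0 <= f a -> 0 <= f b ->
  forall x, a <= x <= b -> 0 <= f x.
Proof.
move=> fdf dfddf ddf_le0 fa fb x /andP[]; rewrite le_eqVlt => /predU1P[<-//|ax].
rewrite le_eqVlt => /predU1P[->//|xb]; rewrite leNgt; apply/negP => fx.
have [u /andP[au ux] fu] := MVT_everywhere _ _ _ _ _ ax fdf.
have [v /andP[xv vb] fv] := MVT_everywhere _ _ _ _ _ xb fdf.
have uv : u < v by exact: lt_trans ux xv.
have [t /andP[ut tv] ft] := MVT_everywhere _ _ _ _ _ uv dfddf.
have dfu : df u < 0 by rewrite -(pmulr_llt0 _ (_ : 0 < x - a)) ?subr_gt0 // -fu; lra.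
have dfv : 0 < df v by rewrite -(pmulr_lgt0 _ (_ : 0 < b - x)) ?subr_gt0 // -fv; lra.
have : ddf t * (v - u) <= 0.
  apply: mulr_le0_ge0; last by rewrite subr_ge0 ltW.
  by apply: ddf_le0; rewrite (ltW (lt_trans au ut)) (ltW (lt_trans tv vb)).
by rewrite -ft; lra.
Qed.

Lemma poly_le_of_second_derivative (R : realType) (f df ddf : R -> R)
    (q : {poly R}) (a b : R) :
  (forall x : R, is_derive x (1 : R) f (df x)) ->
  (forall x : R, is_derive x (1 : R) df (ddf x)) ->
  (forall x, a <= x <= b -> ddf x <= q^`()^`().[x]) ->
  q.[a] <= f a -> q.[b] <= f b -> forall x, a <= x <= b -> q.[x] <= f x.
Proof.
move=> fdf dfddf ddfq qa qb x xab; rewrite -subr_ge0.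
apply: (concave_ge0 _ (f - horner q) (df - horner q^`())
  (ddf - horner q^`()^`()) a b) => //; rewrite ?fctE ?subr_ge0 //.
by move=> y /ddfq; rewrite subr_le0.
Qed.

(** The preceding comparison is applied to both [p] and [- p]. *)
Lemma poly_dominated (R : realType) (p : {poly R}) (f df ddf : R -> R) (a b : R) :
  (forall x : R, is_derive x (1 : R) f (df x)) ->
  (forall x : R, is_derive x (1 : R) df (ddf x)) ->
  (forall x, a <= x <= b -> `|p^`()^`().[x]| <= - ddf x) ->
  p.[a] = 0 -> p.[b] = 0 -> 0 <= f a -> 0 <= f b ->
  forall x, a <= x <= b -> `|p.[x]| <= f x.
Proof.
move=> fdf dfddf dom pa pb fa fb x xab; rewrite ler_norml lerNl -hornerN.
apply/andP; split; apply: (poly_le_of_second_derivative _ f df ddf _ a b) => //;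
  rewrite ?hornerN ?pa ?pb ?oppr0 //.
  by move=> y /dom; rewrite !derivN hornerN ler_norml; lra.
by move=> y /dom; rewrite ler_norml; lra.
Qed.

Lemma is_derive_sin_affine (R : realType) (w p x : R) :
  is_derive x (1 : R) (fun t => sin (w * t + p)) (w * cos (w * x + p)).
Proof.
have -> : w * cos (w * x + p) = cos (w * x + p) * (w *: 'X + p%:P)^`().[x].
  by rewrite derivD derivZ derivX derivC addr0 !hornerE /=; ring.
have -> : (fun t => sin (w * t + p)) = sin \o horner (w *: 'X + p%:P).
  by apply/funext => t /=; rewrite !hornerE.
have -> : w * x + p = (w *: 'X + p%:P).[x] by rewrite !hornerE.
exact: is_derive1_comp.
Qed.

Lemma is_derive_cos_affine (R : realType) (w p x : R) :
  is_derive x (1 : R) (fun t => cos (w * t + p)) (- (w * sin (w * x + p))).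
Proof.
have -> : - (w * sin (w * x + p)) = - sin (w * x + p) * (w *: 'X + p%:P)^`().[x].
  by rewrite derivD derivZ derivX derivC addr0 !hornerE /=; ring.
have -> : (fun t => cos (w * t + p)) = cos \o horner (w *: 'X + p%:P).
  by apply/funext => t /=; rewrite !hornerE.
have -> : w * x + p = (w *: 'X + p%:P).[x] by rewrite !hornerE.
exact: is_derive1_comp.
Qed.

(** By concavity, sin (pi y) >= 2 y on [0, 1/2]. The double angle formula multiplies this bound at
    [x] by the one at 1/2 - [x], where the sine is cos (pi x). *)
Lemma sin_2pi_ge (R : realType) (x : R) :
  0 <= x <= 2^-1 -> 8 * x * (2^-1 - x) <= sin (2 * pi * x).
Proof.
move=> xh; have pi0 : 0 < pi :> R := pi_gt0 R.
have sin_ge (y : R) : 0 <= y <= 2^-1 -> 2 * y <= sin (pi * y).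
  move=> yh; have -> : 2 * y = (2 *: 'X).[y] by rewrite !hornerE.
  rewrite -[pi * y]addr0; apply: (poly_le_of_second_derivative _
    (fun t => sin (pi * t + 0)) (fun t => pi * cos (pi * t + 0))
    (fun t => pi * - (pi * sin (pi * t + 0))) _ 0 2^-1) => //.
  - by move=> t; exact: is_derive_sin_affine.
  - move=> t; exact: is_deriveZ (is_derive_cos_affine _ pi 0 t).
  - move=> t th; rewrite derivZ derivX derivZ derivC scaler0 horner0.
    rewrite mulrN oppr_le0 !pmulr_rge0 //; apply: sin_ge0_pi.
    by rewrite addr0; nra.
  - by rewrite !hornerE /= sin0.
  - by rewrite !hornerE /= sin_pihalf; lra.
have xs := sin_ge x xh; have xc : 2 * (2^-1 - x) <= cos (pi * x).
  have := sin_ge (2^-1 - x) _; rewrite -cosBpihalf -cosN.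
  by rewrite (_ : - (pi * (2^-1 - x) - pi / 2) = pi * x); [apply; lra | ring].
rewrite (_ : 2 * pi * x = (pi * x) *+ 2); last by rewrite -mulr_natl; ring.
by rewrite sin_mulr2n -mulr_natl; nra.
Qed.

(** * Exact order of b_n on [0, 1] *)

Lemma normalized_bernoulli_horner01 (R : numFieldType) (b : nat -> {poly R}) n :
  normalized_bernoulli b -> (b n.+2).[1] = (b n.+2).[0].
Proof.
move=> hb; rewrite -[X in _.[X] = _]add0r normalized_bernoulliD1 //.
by rewrite expr0n mulr0 addr0.
Qed.

Lemma normalized_bernoulli1 (R : numFieldType) (b : nat -> {poly R}) x :
  normalized_bernoulli b -> (b 1%N).[x] = x - 2^-1.
Proof.
move=> hb; rewrite (normalized_bernoulliE _ _ _ hb) big_ord_recl big_ord0 addr0.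
rewrite normalized_bernoulli0 //= hornerD hornerN !hornerE /=.
by rewrite (_ : 2`! = 2)%N // invr1; ring.
Qed.

(** Reflection makes the values at 0 and 1 opposite, while periodicity makes them equal; the index
    [n.+2] keeps b_1 out. *)
Lemma normalized_bernoulli_odd_horner0 (R : numFieldType) (b : nat -> {poly R}) n :
  normalized_bernoulli b -> odd n -> (b n.+2).[0] = 0.
Proof.
move=> hb odd_n; have := normalized_bernoulliB1 _ _ n.+2 0 hb.
rewrite subr0 normalized_bernoulli_horner01 // -signr_odd /= negbK odd_n.
by rewrite expr1 mulN1r => /eqP; rewrite -addr_eq0 -mulr2n mulrn_eq0 => /eqP.
Qed.

Lemma normalized_bernoulli_odd_half (R : numFieldType) (b : nat -> {poly R}) n :
  normalized_bernoulli b -> odd n -> (b n).[2^-1] = 0.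
Proof.
move=> hb odd_n; have := normalized_bernoulliB1 _ _ n 2^-1 hb.
rewrite -signr_odd odd_n expr1 mulN1r (_ : 1 - 2^-1 = 2^-1); last by field.
by move=> /eqP; rewrite -addr_eq0 -mulr2n mulrn_eq0 => /eqP.
Qed.

Lemma normalized_bernoulli_odd_le (R : realType) (b : nat -> {poly R}) (k : nat) :
  normalized_bernoulli b -> forall x : R, 0 <= x <= 2^-1 ->
  `|(b k.*2.+3).[x]| <=
    (2 * pi) ^+ 3 / (2 * pi) ^+ k.*2.+3 * sin (2 * pi * x).
Proof.
move=> hb; set w : R := 2 * pi.
have w0 : 0 < w by rewrite mulr_gt0 ?pi_gt0.
have b0 m : (b m.*2.+3).[0] = 0.
  by rewrite normalized_bernoulli_odd_horner0 //= odd_double.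
have bh m : (b m.*2.+3).[2^-1] = 0.
  by rewrite normalized_bernoulli_odd_half //= negbK odd_double.
elim: k => [|k IHk] x xh.
  rewrite divff ?expf_neq0 ?gt_eqF // mul1r (le_trans _ (sin_2pi_ge _ _ xh)) //.
  (* The second derivative of b_3 is x - 1/2, at most 1/2 in absolute value here, while that of [q]
     is -16. *)
  set q : {poly R} := 8 *: 'X * (2^-1%:P - 'X).
  have -> : 8 * x * (2^-1 - x) = q.[x] by rewrite !hornerE.
  apply: (poly_dominated _ _ (horner q) (horner q^`()) (horner q^`()^`()) 0 2^-1)
    => // [t th||].
  - rewrite !deriv_normalized_bernoulli // normalized_bernoulli1 //.
    rewrite /q !(derivM, derivD, derivN, derivC, derivX, derivZ) !hornerE /=.
    by rewrite ler_norml; lra.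
  - by rewrite !hornerE.
  - by rewrite !hornerE subrr mulr0.
(* Raising the index by two divides the constant by w^2, which is the factor that two derivatives of
   the sine give back. *)
have Kw : w ^+ 3 / w ^+ k.*2.+3 = w ^+ 3 / w ^+ k.+1.*2.+3 * w ^+ 2.
  have wn0 : w != 0 by rewrite gt_eqF.
  have wkn0 : w ^+ k.*2 != 0 by rewrite expf_neq0.
  by rewrite doubleS !exprS; field; rewrite ?wn0 ?wkn0.
set K := w ^+ 3 / w ^+ k.+1.*2.+3 in Kw *.
rewrite -[w * x]addr0; apply: (poly_dominated _ _ (fun t => K * sin (w * t + 0))
  (fun t => K * (w * cos (w * t + 0))) (fun t => K * (w * - (w * sin (w * t + 0))))
  0 2^-1) => //.
- by move=> t; exact: is_deriveZ (is_derive_sin_affine _ w 0 t).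
- move=> t; apply: (@is_deriveZ _ _ _ (fun t => w * cos (w * t + 0)) K).
  exact: is_deriveZ (is_derive_cos_affine _ w 0 t).
- move=> t th; rewrite doubleS !deriv_normalized_bernoulli // addr0.
  by have := IHk t th; rewrite Kw; move: (sin _) => z; congr (_ <= _); ring.
- by rewrite mulr0 addr0 sin0 mulr0.
- rewrite addr0 /w (_ : 2 * pi / 2 = pi) ?sinpi ?mulr0 //; by field.
Qed.

Lemma normalized_bernoulli_le (R : realType) (b : nat -> {poly R}) (n : nat) (x : R) :
  normalized_bernoulli b -> (3 <= n)%N -> 0 <= x <= 1 ->
  `|(b n).[x]| <= (2 * pi) ^+ 4 / (2 * pi) ^+ n.
Proof.
move=> hb n3; have w1 : 1 <= 2 * pi :> R by have := pi_ge2 R; lra.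
have w0 : 0 < 2 * pi :> R by apply: lt_le_trans w1.
have odd_le k (y : R) : 0 <= y <= 1 ->
    `|(b k.*2.+3).[y]| <= (2 * pi) ^+ 3 / (2 * pi) ^+ k.*2.+3.
  have Kge0 : 0 <= (2 * pi) ^+ 3 / (2 * pi) ^+ k.*2.+3 :> R.
    by rewrite divr_ge0 // exprn_ge0 // ltW.
  wlog yh : y / y <= 2^-1.
    move=> W y01; have [yh|yh] := leP y 2^-1; first exact: W.
    have -> : `|(b k.*2.+3).[y]| = `|(b k.*2.+3).[1 - y]|.
      by rewrite normalized_bernoulliB1 // normrM normr_sign mul1r.
    by apply: W; lra.
  move=> /andP[y0 _]; apply: (le_trans (normalized_bernoulli_odd_le _ _ k hb y _)).
    by rewrite y0.
  by rewrite ler_piMr // sin_le1.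
have [[k ->]|[k ->]] : (exists k, n = k.*2.+3) \/ (exists k, n = k.*2.+4).
  case: n n3 => [|[|[|m]]] // _; rewrite -(odd_double_half m).
  by case: (odd m); [right | left]; exists m./2.
- move=> x01; apply: le_trans (odd_le k x x01) _.
  by rewrite ler_pM2r ?invr_gt0 ?exprn_gt0 // ler_weXn2l.
(* For even index, Rolle's theorem for the next polynomial, which has equal values at 0 and 1,
   yields a zero [z]; the odd bound on the derivative then controls the distance from 0. *)
move=> x01; have [z /andP[z0 z1]] := MVT_everywhere _ _ _ 0 1 ltr01
  (fun t => is_derive_poly (b k.*2.+4.+1) t).
rewrite normalized_bernoulli_horner01 // subrr subr0 mulr1.
rewrite deriv_normalized_bernoulli // => bz.
have -> : (2 * pi) ^+ 4 / (2 * pi) ^+ k.*2.+4 = (2 * pi) ^+ 3 / (2 * pi) ^+ k.*2.+3 :> R.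
  by rewrite 2!exprS invfM mulrACA divff ?gt_eqF // mul1r.
have bd (u v : R) : 0 <= u -> u < v -> v <= 1 ->
    `|(b k.*2.+4).[v] - (b k.*2.+4).[u]| <= (2 * pi) ^+ 3 / (2 * pi) ^+ k.*2.+3.
  move=> u0 uv v1; have [c /andP[uc cv] ->] := MVT_everywhere _ _ _ _ _ uv
    (fun t => is_derive_poly (b k.*2.+4) t).
  rewrite deriv_normalized_bernoulli // normrM.
  rewrite (le_trans _ (odd_le k c _)) //; last by lra.
  by rewrite ler_piMr // ger0_norm; lra.
have [xz|zx|->] := ltgtP x z.
- by have := bd x z; rewrite -bz sub0r normrN; apply; lra.
- by have := bd z x; rewrite -bz subr0; apply; lra.
- by rewrite -bz normr0 divr_ge0 // exprn_ge0 // ltW.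
Qed.

Lemma exists_normalized_bernoulli_le (R : realType) (b : nat -> {poly R}) (n : nat) :
  normalized_bernoulli b -> (1 <= n)%N ->
  exists2 s : R, 0 < s < 1 & (b n).[s] <= - (2 * (2 * pi) ^+ n)^-1.
Proof.
move=> hb n1; set w : R := 2 * pi.
have w0 : 0 < w by rewrite mulr_gt0 ?pi_gt0.
(* The phase is chosen so that the derivative of [c k] is [- w] times [c k.+1], without a change of
   function. *)
pose c (k : nat) (s : R) := cos (w * s + - (k%:R * (pi / 2))).
have c'E k s : is_derive s (1 : R) (c k) (- (w * c k.+1 s)).
  have := is_derive_cos_affine _ w (- (k%:R * (pi / 2))) s.
  congr (is_derive _ _ _ (- (w * _))).
  by rewrite /c -cosBpihalf; congr cos; rewrite -natr1; ring.
have c1 k : c k 1 = c k 0.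
  rewrite /c (_ : _ + _ = w * 0 - k%:R * (pi / 2) + pi *+ 2) ?cosD2pi //.
  by rewrite -mulr_natl /w; ring.
(* [P k] is the primitive of [b_k c_k] given by repeated integration by parts. *)
pose P := fix P (k : nat) : R -> R := if k is k'.+1
  then w^-1 *: (P k' - (horner (b k)) * c k') else w^-1 *: (fun s => sin (w * s + 0)).
have P'E k s : is_derive s (1 : R) (P k) ((b k).[s] * c k s).
  elim: k => [|k IHk].
    have := is_deriveZ w^-1 (is_derive_sin_affine _ w 0 s).
    congr is_derive; rewrite normalized_bernoulli0 // hornerC mul1r /c mul0r oppr0.
    by rewrite /GRing.scale /= mulrA mulVf ?mul1r // gt_eqF.
  have := is_deriveZ w^-1 (is_deriveB IHk (is_deriveM (is_derive_poly (b k.+1) s) (c'E k s))).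
  congr is_derive.
  rewrite deriv_normalized_bernoulli //.
  rewrite /GRing.scale /=; field.
  by rewrite gt_eqF.
have PS k s : P k.+1 s = w^-1 * (P k s - (b k.+1).[s] * c k s) by [].
(* The boundary term of b_1 gives - 1 / w; all later boundary terms cancel by periodicity, and each
   step divides by [w]. *)
have dP k : P k.+1 1 - P k.+1 0 = - w ^- k.+1.
  elim: k => [|k IHk].
    have c0 : c 0%N 0 = 1 by rewrite /c mulr0 mul0r oppr0 addr0 cos0.
    have P0 : P 0%N 1 = P 0%N 0.
      rewrite /P /GRing.scale /= mulr0 !addr0 mulr1 sin0.
      by rewrite /w mulr_natl sin2pi.
    by rewrite !PS c1 c0 P0 !normalized_bernoulli1 // expr1; lra.
  rewrite !(PS k.+1) !c1 normalized_bernoulli_horner01 // -mulrBr.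
  rewrite opprB addrA addrNK.
  by rewrite IHk mulrN -invfM -exprS.
case: n n1 => // n _.
(* The function is a primitive of b_(n+1) (1 + c_(n+1)), so the mean value theorem replaces the
   integral. The weight lies in [0, 2], hence the factor 2 in the bound. *)
have [|s s01] := MVT_everywhere _ (horner (b n.+2) + P n.+1)
  (fun t => (b n.+1).[t] + (b n.+1).[t] * c n.+1 t) 0 1 ltr01.
  move=> t; rewrite -{1}(deriv_normalized_bernoulli _ _ n.+1 hb).
  exact: is_deriveD.
rewrite !fctE normalized_bernoulli_horner01 // subr0 mulr1 => E.
exists s => //.
have {}E : (b n.+1).[s] * (1 + c n.+1 s) = - w ^- n.+1.
  by rewrite -dP mulrDr mulr1 -E; ring.
rewrite invfM -mulrN -E.
have u2 : 1 + c n.+1 s <= 2 by rewrite -lerBrDl (le_trans (cos_le1 _)) //; lra.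
have u0 : 0 <= 1 + c n.+1 s by rewrite -lerBlDl sub0r cos_geN1.
have vu : (b n.+1).[s] * (1 + c n.+1 s) < 0.
  by rewrite E oppr_lt0 invr_gt0 exprn_gt0.
move: (1 + _) u2 u0 vu => u u2 u0 vu.
have v0 : (b n.+1).[s] < 0 by rewrite ltNge; apply/negP => v0; nra.
nra.
Qed.

(** * Stirling's formula up to a constant factor *)

Lemma two_le_expR1 (R : realType) : 2 <= expR 1 :> R.
Proof. by have := expR_ge1Dx (1 : R). Qed.

Lemma sinh_ge (R : realType) (u : R) : 0 <= u -> 2 * u <= expR u - expR (- u).
Proof.
rewrite le_eqVlt => /predU1P[<-|u0]; first by rewrite mulr0 oppr0 subrr.
have [t|c _] := MVT_everywhere _ (expR - (expR \o horner (- 'X)) - horner (2 *: 'X))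
  (fun t => expR t + expR (- t) - 2) 0 u u0.
  have -> : expR t + expR (- t) - 2 = expR t -
      expR (- 'X).[t] * (- 'X)^`().[t] - (2 *: 'X)^`().[t].
    by rewrite derivN derivZ derivX !hornerE /=; ring.
  exact: (is_deriveB (is_deriveB (is_derive_expR t) (is_derive1_comp
    (is_derive_expR _) (is_derive_poly (- 'X) t))) (is_derive_poly (2 *: 'X) t)).
rewrite !fctE !hornerE /= oppr0 expR0 subrr => E.
have := expR_ge1Dx c; have := expR_ge1Dx (- c).
by nra.
Qed.

(** The function (t - 2) e^t + t equals -2 at 0, and its derivative 1 + (t - 1) e^t is nonnegative
    because 1 - t <= e^(-t). *)
Lemma tanh_le (R : realType) (u : R) : 0 <= u -> 2 * (expR u - 1) <= u * (expR u + 1).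
Proof.
rewrite le_eqVlt => /predU1P[<-|u0]; first by rewrite expR0 subrr mulr0 mul0r.
have [t|c /andP[c0 _]] := MVT_everywhere _ (horner ('X - 2%:P) * expR + horner 'X)
  (fun t => 1 + (t - 1) * expR t) 0 u u0.
  have -> : 1 + (t - 1) * expR t =
      ('X - 2%:P).[t] * expR t + expR t * ('X - 2%:P)^`().[t] + ('X)^`().[t].
    by rewrite derivB derivX derivC subr0 !hornerE /=; ring.
  exact: (is_deriveD (is_deriveM (is_derive_poly ('X - 2%:P) t)
    (is_derive_expR t)) (is_derive_poly 'X t)).
rewrite !fctE !hornerE /= expR0 => E.
have : 0 <= (1 + (c - 1) * expR c) * (u - 0).
  apply: mulr_ge0; last by lra.
  have := expR_ge1Dx (- c); rewrite -(ler_pM2r (expR_gt0 c)).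
  by rewrite [expR (- c) * _]mulrC expRxMexpNx_1; lra.
by rewrite -E; lra.
Qed.

(* With [u = ln (1 + 1 / n)], the two bounds are [tanh (u / 2) <= u / 2] and
   [u <= sinh u]. *)
Lemma stirling_step (R : realType) (n : nat) : (0 < n)%N ->
  0 <= (n%:R + 2^-1) * (ln (n.+1%:R : R) - ln n%:R) - 1 <=
    (4 * n%:R)^-1 - (4 * n.+1%:R)^-1.
Proof.
move=> n0; have x0 : 0 < n%:R :> R by rewrite ltr0n.
rewrite -[n.+1%:R]natr1; set x : R := n%:R in x0 *.
have y0 : 0 < x + 1 by lra.
rewrite -ln_div ?posrE //.
set u := ln _; have eu : expR u = (x + 1) / x by rewrite lnK // posrE divr_gt0.
have u0 : 0 <= u by rewrite ln_ge0 // ler_pdivlMr //; lra.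
have := sinh_ge R u u0; have := tanh_le R u u0; rewrite expRN eu => h1 h2.
apply/andP; split.
  have : (x + 1) / x - 1 = x^-1 by field; rewrite gt_eqF.
  have : (x + 1) / x + 1 = 2 + x^-1 by field; rewrite gt_eqF.
  move=> e1 e2; move: h1; rewrite e1 e2 => h1.
  have := mulVf (lt0r_neq0 x0); nra.
(* Both sides equal 1 / (4 x (x + 1)); the right one has the form that [sinh_ge] bounds. *)
have e1 : (4 * x)^-1 - (4 * (x + 1))^-1 =
    2^-1 * (x + 2^-1) * ((x + 1) / x - x / (x+1)) - 1.
  by field; rewrite !gt_eqF.
rewrite e1 lerB // -mulrA mulrCA ler_pM2l; last by lra.
by move: h2; rewrite invf_div; lra.
Qed.

(** Let d_n be the middle quantity. By [stirling_step], d_n decreases and d_n - 1 / (4 n) increases;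
    both bounds come from d_1 = 1. *)
Lemma stirling (R : realType) (n : nat) : (0 < n)%N ->
  3 / 4 <= ln (n`!%:R : R) - ((n%:R + 2^-1) * ln n%:R - n%:R) <= 1.
Proof.
case: n => // n _.
suff : 3 / 4 + (4 * n.+1%:R)^-1 <=
    ln (n.+1`!%:R : R) - ((n.+1%:R + 2^-1) * ln n.+1%:R - n.+1%:R) <= 1.
  have : 0 <= (4 * n.+1%:R)^-1 :> R by rewrite invr_ge0 mulr_ge0.
  by move=> z0 /andP[h1 ->]; rewrite andbT (le_trans _ h1) // lerDl.
elim: n => [|n IHn].
  rewrite (_ : 1`! = 1)%N // ln1 mulr0 mulr1; apply/andP; split; lra.
have := stirling_step R n.+1 isT.
rewrite [in n.+2`!]factS natrM lnM ?posrE ?ltr0n ?fact_gt0 //.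
move: IHn; rewrite -[n.+2%:R]natr1.
move: (ln ((n.+1)`!%:R : R)) (ln (n.+1%:R : R)) ((4 * n.+1%:R)^-1 : R)
  ((4 * (n.+1%:R + 1))^-1 : R) => lf l1 z1 z2.
move: (n.+1%:R) => x /andP[h1 h2] /andP[h3 h4]; apply/andP; split; lra.
Qed.

(** * Sums of powers and growth of b_n *)

(** For positive [z] this is Bernoulli's inequality (1 + 1 / z)^n >= 1 + n / z >= 2; [main] states
    it with denominators cleared. *)
Lemma double_expr_le (R : realType) (n : nat) (z : R) : (0 < n)%N ->
  0 <= z <= n%:R -> 2 * z ^+ n <= (z + 1) ^+ n.
Proof.
move=> n0 /andP[]; rewrite le_eqVlt => /predU1P[<- _|z0 zn].
  by rewrite expr0n gtn_eqF // mulr0 add0r expr1n.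
have main k : z ^+ k * (z + k%:R) <= (z + 1) ^+ k * z.
  elim: k => [|k IHk]; first by rewrite !expr0 addr0.
  rewrite !exprS -natr1.
  have : 0 <= z ^+ k * k%:R by rewrite mulr_ge0 // exprn_ge0 // ltW.
  by move: (z ^+ k) ((z + 1) ^+ k) IHk => u v; nra.
rewrite -(ler_pM2r z0) (le_trans _ (main n)) // mulrAC mulrC ler_pM2l ?exprn_gt0 //.
by lra.
Qed.

(** By induction the sum up to s + m is at most 2 (s + m)^n, and doubling is absorbed by moving one
    unit to the right. *)
Lemma sum_expr_le (R : realType) (n m : nat) (s : R) : (0 < n)%N -> 0 <= s ->
  s + m%:R <= n%:R + 1 -> \sum_(j < m) (s + j%:R) ^+ n <= (s + m%:R) ^+ n.
Proof.
move=> n0 s0; elim: m => [|m IHm].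
  by rewrite big_ord0 exprn_ge0 // addr0.
rewrite -natr1 addrA lerD2r => smn; rewrite big_ord_recr /=.
have sm0 : 0 <= s + m%:R by rewrite addr_ge0.
rewrite (le_trans _ (double_expr_le _ _ _ n0 _)) ?sm0 //.
have := IHm (ler_wpDr ler01 smn); lra.
Qed.

(** With x = s + m + 1 and [s] the fractional part, only the largest power, at x - 1 = s + m, is
    kept from the sum. *)
Lemma normalized_bernoulli_ge (R : realType) (b : nat -> {poly R}) (n : nat) (x : R) :
  normalized_bernoulli b -> (2 <= n)%N -> 1 <= x ->
  (x - 1) ^+ n / n`!%:R - (2 * pi) ^+ 4 / (2 * pi) ^+ n.+1 <= (b n.+1).[x].
Proof.
move=> hb n2 x1; have /andP[] := truncn_itv (le_trans ler01 x1).
have : (0 < Num.truncn x)%N by rewrite truncn_gt0.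
case: (Num.truncn x) => // m _ mx xm.
pose s := x - m.+1%:R; have s01 : 0 <= s <= 1.
  by rewrite subr_ge0 mx /= lerBlDl natr1 ltW.
have -> : x = s + m.+1%:R by rewrite subrK.
have f0 : 0 < n`!%:R^-1 :> R by rewrite invr_gt0 ltr0n fact_gt0.
have := normalized_bernoulli_le _ _ n.+1 s hb n2 s01.
move: (_ / (2 * pi) ^+ n.+1) => K; rewrite ler_norml => /andP[Kb _].
rewrite normalized_bernoulliDn // big_ord_recr /= mulrDr.
have -> : s + m.+1%:R - 1 = s + m%:R by rewrite -natr1; ring.
rewrite [_ / n`!%:R]mulrC; have : 0 <= n`!%:R^-1 * \sum_(i < m) (s + i%:R) ^+ n.
  rewrite pmulr_rge0 // sumr_ge0 // => i _; rewrite exprn_ge0 // addr_ge0 //.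
  by case/andP: s01.
lra.
Qed.

Lemma normalized_bernoulli_root_gt (R : realType) (b : nat -> {poly R}) (n : nat) (x : R) :
  normalized_bernoulli b -> (2 <= n)%N -> 0 <= x -> (b n.+1).[x] < 0 ->
  exists2 z, x <= z & root (b n.+1) z.
Proof.
move=> hb n2 x0 bx; set K : R := (2 * pi) ^+ 4 / (2 * pi) ^+ n.+1.
have f0 : 0 < n`!%:R :> R by rewrite ltr0n fact_gt0.
have K0 : 0 <= K by rewrite divr_ge0 // exprn_ge0 // mulr_ge0 // pi_ge0.
(* This choice gives v^n >= v >= n! K, so that b_(n+1) is nonnegative at v + 1, beyond [x]. *)
pose v : R := 1 + x + n`!%:R * K; have fK : 0 <= n`!%:R * K by rewrite mulr_ge0 // ltW.
have v1 : 1 <= v by rewrite /v; lra.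
have v2 : 1 <= v + 1 by lra.
have bv := normalized_bernoulli_ge _ _ n (v + 1) hb n2 v2; rewrite addrK -/K in bv.
have [||z /andP[xz _] rz] := @poly_ivt _ (b n.+1) x (v + 1).
- by rewrite /v; lra.
- rewrite (ltW bx) (le_trans _ bv) // subr_ge0 ler_pdivlMr // mulrC.
  rewrite (le_trans _ (ler_eXnr _ v1)) ?(leq_trans _ n2) //.
  by rewrite /v; lra.
- by exists z.
Qed.

(** * Lower and upper bounds for the largest root *)

Lemma ln_scale (R : realType) (n : nat) : (0 < n)%N ->
  ln (n%:R / (2 * pi * expR 1) : R) = ln n%:R - ln (2 * pi) - 1.
Proof.
move=> n0; have pi0 := pi_gt0 R; have w0 : 0 < 2 * pi :> R by lra.
rewrite ln_div ?posrE ?ltr0n ?mulr_gt0 ?expR_gt0 //.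
by rewrite lnM ?posrE ?expR_gt0 // expRK opprD addrA.
Qed.

Lemma normalized_bernoulli_root_ge (R : realType) (b : nat -> {poly R}) (n : nat) :
  normalized_bernoulli b -> (2 <= n)%N -> 2 * (2 * pi * expR 1) <= n%:R :> R ->
  exists2 z, n%:R / (2 * pi * expR 1) + ln n%:R / (2 * (2 * pi * expR 1)) - 2 <= z
    & root (b n.+1) z.
Proof.
move=> hb n2 ntau; have n0 : (0 < n)%N by exact: leq_trans n2.
have w4 : 4 <= 2 * pi :> R by have := pi_ge2 R; lra.
have [s /andP[s0 s1] bs] := exists_normalized_bernoulli_le _ _ n.+1 hb isT.
have lnT := ln_scale R n n0.
have e2 := two_le_expR1 R.
move: (2 * pi) w4 ntau bs lnT => w w4 ntau bs lnT.
set tau := w * expR 1 in ntau lnT *.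
have tau8 : 2 * w <= tau by rewrite mulrC ler_wpM2l //; lra.
have tau0 : 0 < tau by lra.
have x0 : 0 < n%:R :> R by rewrite ltr0n.
have lnx0 : 0 <= ln n%:R :> R by rewrite ln_ge0 // ler1n.
have lnxx := ln_sublinear x0.
have /andP[stir _] := stirling R n n0.
set x : R := n%:R in ntau lnT x0 lnx0 lnxx stir *.
set T := x / tau in lnT *; set a := ln x / (2 * tau).
have T2 : 2 <= T by rewrite ler_pdivlMr.
have T0 : 0 < T by lra.
have a0 : 0 <= a by rewrite divr_ge0 //; lra.
(* With [aN], this keeps [X] below [n], in the range where [sum_expr_le] applies. *)
have TN : T <= x / 2 by rewrite ler_pM2l // lef_pV2 ?posrE //; lra.
have aN : a <= x / 2.
  apply: ler_pM; [exact: lnx0 | | exact: ltW |]; first by rewrite invr_ge0; lra.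
  by rewrite lef_pV2 ?posrE //; lra.
set X := T + a - 1.
have X1 : 1 <= X by rewrite /X; lra.
have Xs : 0 <= X - s by lra.
have /andP[] := truncn_itv Xs; set m := Num.truncn _; rewrite -natr1 => mX Xm.
have m0 : 0 <= m%:R :> R by [].
have bsm : (b n.+1).[s + m%:R] < 0.
  rewrite normalized_bernoulliDn //.
  have snx : s + m%:R <= n%:R + 1 by rewrite -/x; move: mX; rewrite /X; lra.
  have f0 : 0 < n`!%:R :> R by rewrite ltr0n fact_gt0.
  have : n`!%:R^-1 * (\sum_(j < m) (s + j%:R) ^+ n) <= n`!%:R^-1 * X ^+ n.
    rewrite ler_pM2l ?invr_gt0 // (le_trans (sum_expr_le _ _ _ _ n0 (ltW s0) snx)) //.
    by rewrite lerXn2r ?nnegrE; lra.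
  have : n`!%:R^-1 * X ^+ n < (2 * w ^+ n.+1)^-1.
    have wn0 : 0 < w ^+ n.+1 by rewrite exprn_gt0; lra.
    have Xn0 : 0 < X ^+ n by rewrite exprn_gt0; lra.
    rewrite mulrC ltr_pdivrMr // mulrC ltr_pdivlMr ?mulr_gt0 //.
    rewrite -ltr_ln ?posrE ?mulr_gt0 //.
    rewrite lnM ?posrE ?mulr_gt0 // exprS mulrA lnM ?posrE ?exprn_gt0 //; [|lra..].
    rewrite !lnXn; [|lra..].
    rewrite -[ln X *+ n]mulr_natl -[ln w *+ n]mulr_natl -/x.
    have lw : ln (2 * w) < tau.
      by apply: lt_le_trans tau8; apply: ln_sublinear; lra.
    have lX : x * ln X <= x * ln T + ln x / 2 - tau.
      have -> : X = T * (1 + (a - 1) / T) by rewrite /X; field; lra.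
      have XT0 : 0 < 1 + (a - 1) / T.
        have -> : 1 + (a - 1) / T = X / T by rewrite /X; field; lra.
        by rewrite divr_gt0 //; lra.
      rewrite lnM ?posrE // mulrDr -addrA lerD2l.
      have -> : ln x / 2 - tau = x * ((a - 1) / T).
        by rewrite /a /T; field; rewrite !gt_eqF.
      by rewrite ler_pM2l // le_ln1Dx //; lra.
    rewrite lnT in lX; lra.
  by lra.
have sm0 : 0 <= s + m%:R by lra.
have [z smz rz] := normalized_bernoulli_root_gt _ _ _ _ hb n2 sm0 bsm.
by exists z => //; move: Xm; rewrite /X; lra.
Qed.

Lemma expR_le_quadratic (R : realType) (u : R) : 0 <= u <= 2^-1 ->
  expR u <= 1 + u + 2 * u ^+ 2.
Proof.
move=> uh; have e0 := expR_gt0 u.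
have : (1 - u) * expR u <= 1.
  by rewrite -[leRHS](expRxMexpNx_1 u) [leRHS]mulrC ler_pM2r // expR_ge1Dx.
by move: (expR u) e0 => e e0 h; nra.
Qed.

Lemma normalized_bernoulli_root_le (R : realType) (b : nat -> {poly R}) :
  normalized_bernoulli b -> exists K : R, forall (n : nat) (y : R),
  (2 <= n)%N -> K <= n%:R -> root (b n.+1) y ->
  y <= n%:R / (2 * pi * expR 1) + ln n%:R / (2 * (2 * pi * expR 1)) + K.
Proof.
move=> hb; pose k : R := 1 + 3 * ln (2 * pi).
exists (8 + 4 * k + 4 * k ^+ 2) => n y n2 nK rb.
have n0 : (0 < n)%N by exact: leq_trans n2.
have w4 : 4 <= 2 * pi :> R by have := pi_ge2 R; lra.
have ge1 : 1 <= y -> (y - 1) ^+ n / n`!%:R <= (2 * pi) ^+ 4 / (2 * pi) ^+ n.+1.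
  move=> y1; have := normalized_bernoulli_ge _ _ _ _ hb n2 y1.
  by move/rootP: rb => ->; rewrite subr_le0.
have lnT := ln_scale R n n0.
have e2 := two_le_expR1 R.
move: (2 * pi) @k nK w4 ge1 lnT => w k nK w4 ge1 lnT.
have w0 : 0 < w by lra.
have lw0 : 0 <= ln w by apply: ln_ge0; lra.
have k1 : 1 <= k by rewrite /k; lra.
set tau := w * expR 1 in lnT *.
have tau8 : 2 * w <= tau by rewrite mulrC ler_wpM2l //; lra.
have x0 : 0 < n%:R :> R by rewrite ltr0n.
have L0 : 0 <= ln n%:R :> R by rewrite ln_ge0 // ler1n.
have L2 : (ln n%:R) ^+ 2 <= 2 * n%:R :> R.
  have := expR_ge1Dxn 1 L0; rewrite lnK ?posrE // (_ : 2`! = 2)%N //; lra.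
have /andP[_ stir] := stirling R n n0.
set x : R := n%:R in nK lnT x0 L0 L2 stir *.
set T := x / tau in lnT *.
have tau0 : 0 < tau by lra.
have T0 : 0 < T by rewrite divr_gt0.
have a0 : 0 <= ln x / (2 * tau) by rewrite divr_ge0 //; lra.
have [y1|y1] := leP y 1; first by nra.
have {}ge1 := ge1 (ltW y1).
set t := y - 1 in ge1; have t0 : 0 < t by rewrite /t; lra.
pose u := (ln x / 2 + k) / x.
have lt : ln t <= ln T + u.
  have f0 : 0 < n`!%:R :> R by rewrite ltr0n fact_gt0.
  have wn0 : 0 < w ^+ n by rewrite exprn_gt0; lra.
  have w30 : 0 < w ^+ 3 by rewrite exprn_gt0; lra.
  have : t ^+ n * w ^+ n <= n`!%:R * w ^+ 3.
    move: ge1; rewrite ler_pdivrMr // exprS [w ^+ n.+1]exprS.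
    have -> : w * w ^+ 3 / (w * w ^+ n) = w ^+ 3 / w ^+ n.
      by field; rewrite !gt_eqF.
    by rewrite mulrAC ler_pdivlMr // [w ^+ 3 * _]mulrC.
  rewrite -ler_ln ?posrE ?mulr_gt0 ?exprn_gt0 //.
  rewrite [ln (t ^+ n * _)]lnM ?posrE ?exprn_gt0 //.
  rewrite [ln (n`!%:R * _)]lnM ?posrE // !lnXn //.
  rewrite -[ln t *+ n]mulr_natl -[ln w *+ n]mulr_natl -[ln w *+ 3]mulr_natl -/x => h.
  rewrite -(ler_pM2l x0) mulrDr [x * u]mulrC /u divfK ?gt_eqF // lnT /k.
  by lra.
have ux : u * x = ln x / 2 + k by rewrite /u divfK ?gt_eqF.
have u0 : 0 <= u by rewrite divr_ge0 ?ltW //; lra.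
have u1 : u <= 2^-1.
  rewrite -(ler_pM2r x0) ux. nra.
have tT : t <= T * expR u.
  have e0 := expR_gt0 u; have Te0 : 0 < T * expR u by exact: mulr_gt0.
  by rewrite -(ler_ln t0 Te0) (lnM T0 e0) expRK.
have uh : 0 <= u <= 2^-1 by rewrite u0.
have Tu : T * u = ln x / (2 * tau) + k / tau.
  by rewrite /T /u; field; rewrite !gt_eqF.
have ktau : k / tau <= k by rewrite ler_pdivrMr // ler_peMr; lra.
have Tuu : T * u ^+ 2 <= 1 + 2 * k ^+ 2.
  have -> : T * u ^+ 2 = (ln x / 2 + k) ^+ 2 / x / tau.
    by rewrite /T /u; field; rewrite !gt_eqF.
  rewrite ler_pdivrMr // ler_pdivrMr //.
  have h1 : (ln x / 2 + k) ^+ 2 <= x + 2 * k ^+ 2.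
    by have := sqr_ge0 (ln x / 2 - k); nra.
  have h2 : x + 2 * k ^+ 2 <= (1 + 2 * k ^+ 2) * x by nra.
  have h3 : (1 + 2 * k ^+ 2) * x <= (1 + 2 * k ^+ 2) * tau * x.
    by rewrite ler_pM2r // ler_peMr; nra.
  exact: le_trans h1 (le_trans h2 h3).
have : t <= T * (1 + u + 2 * u ^+ 2).
  by rewrite (le_trans tT) // ler_pM2l // expR_le_quadratic.
by rewrite /t; nra.
Qed.

Theorem theorem1 (R : realType) (B : nat -> {poly rat}) (y : nat -> R)
    (hB : bernoulli_polynomials B)
    (hy : forall n : nat, (1 <= n)%N -> largest_real_root (B n) (y n)) :
  y = (fun n : nat => n%:R / (2 * pi * expR 1) + ln n%:R / (4 * pi * expR 1))
      +O_\oo (fun=> 1 : R).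
Proof.
have hb := normalized_bernoulli_map R B hB.
set b : nat -> {poly R} := fun n => _ in hb.
have rootb n z : root (b n) z = root (map_poly ratr (B n)) z.
  by rewrite rootZ // invr_neq0 // fact_neq0.
have [K yK] := normalized_bernoulli_root_le _ _ hb.
have e2 := two_le_expR1 R; have pi2 := pi_ge2 R.
have w4 : 4 <= 2 * pi :> R by lra.
apply/eqaddOP; near=> C; near=> n; rewrite normr1 mulr1 !fctE.
have -> : 4 * pi * expR 1 = 2 * (2 * pi * expR 1) :> R by ring.
have KC : K <= C by near: C; apply: nbhs_pinfty_ge; exact: num_real.
have C4 : 4 <= C by near: C; apply: nbhs_pinfty_ge; exact: num_real.
have Kn : K + 1 <= n%:R by near: n; exact: nbhs_infty_ger.
have taun : 2 * (2 * pi * expR 1) + 1 <= n%:R :> R.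
  by near: n; exact: nbhs_infty_ger.
have n3 : (3 <= n)%N by near: n; exact: nbhs_infty_ge.
have [m n2 nm] : exists2 m, (2 <= m)%N & n = m.+1.
  by case: (n) n3 => // m ?; exists m.
move: Kn taun; rewrite nm -natr1 !lerD2r => Kn taun.
have [ry maxy] := hy m.+1 isT; rewrite -rootb in ry.
have le_y := yK m _ n2 Kn ry.
have [z ge_z] := normalized_bernoulli_root_ge _ _ _ hb n2 taun.
rewrite rootb => /maxy zy.
have tau8 : 8 <= 2 * pi * expR 1 :> R by nra.
have n1 : 1 <= m%:R :> R by rewrite ler1n; exact: leq_trans n2.
have ln_n : ln m%:R <= ln (m%:R + 1) :> R by rewrite ler_ln ?posrE; lra.
have ln_n1 : ln (m%:R + 1) <= ln m%:R + 1 :> R.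
  have -> : m%:R + 1 = m%:R * (1 + m%:R^-1) :> R by field; lra.
  have i0 : 0 < m%:R^-1 :> R by rewrite invr_gt0; lra.
  rewrite lnM ?posrE; [|lra..]; rewrite lerD2l.
  apply: le_trans (le_ln1Dx _) _; first lra.
  by rewrite invf_le1 //; lra.
move: (2 * pi * expR 1) tau8 le_y ge_z => tau tau8 le_y ge_z.
have tauV : 0 < tau^-1 <= 1 by rewrite invr_gt0 invf_le1; lra.
move: le_y ge_z; rewrite invfM => le_y ge_z.
rewrite ler_norml; apply/andP; split; nra.
Unshelve. all: by end_near. Qed.
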